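(* Let $d\ge 1$ be an integer, let $\alpha_1,\dots,\alpha_d$ be real numbers with $\alpha_i>-1$ for all $i\in\{1,2,\dots,d\}$. Then for all $x\in(0,j_{\alpha,1})$ the following sharp exponential Redheffer-type inequalities hold: $$\left(\frac{j_{\alpha,1}^{d+1}-x^{d+1}}{j_{\alpha,1}^{d+1}}\right)^{a_{\alpha}}\le\mathcal{J}_{\alpha}(x)\le\left(\frac{j_{\alpha,1}^{d+1}-x^{d+1}}{j_{\alpha,1}^{d+1}}\right)^{b_{\alpha}},$$ where $$a_{\alpha}=\frac{j_{\alpha,1}^{d+1}}{(d+1)^{d+1}A(\alpha)}\qquad\text{and}\qquad b_{\alpha}=1$$ are the best possible constants.
   Context: Write $\alpha=(\alpha_1,\dots,\alpha_d)$ and $A(\alpha)=\prod_{i=1}^d(\alpha_i+1)$. The normalized hyper-Bessel function is $$\mathcal{J}_{\alpha}(z)=\sum_{n\ge 0}\frac{(-1)^n}{n!\,(\alpha_1+1)_n\cdots(\alpha_d+1)_n}\left(\frac{z}{d+1}\right)^{n(d+1)},$$ with $(\beta)_0=1$ and $(\beta)_n=\beta(\beta+1)\cdots(\beta+n-1)$ for $n\ge1$, and $j_{\alpha,1}$ denotes its smallest positive zero. ''Best possible'' means that $a_{\alpha}$ is the smallest real exponent for which the left inequality holds for all $x\in(0,j_{\alpha,1})$, and $b_{\alpha}$ is the largest real exponent for which the right inequality holds for all $x\in(0,j_{\alpha,1})$. *)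

(* Defs.v *)
From HB Require Import structures.
From mathcomp Require Import all_boot all_order all_algebra.
From mathcomp Require Import all_classical all_reals all_analysis.

Set Implicit Arguments.
Unset Strict Implicit.
Unset Printing Implicit Defensive.

Import Order.TTheory GRing.Theory Num.Theory.
Import numFieldNormedType.Exports.

Local Open Scope classical_set_scope.
Local Open Scope ring_scope.

Definition pochhammer (R : realType) (b : R) (n : nat) : R :=
  \prod_(k < n) (b + k%:R).

Definition hyper_bessel_term (R : realType) (d : nat) (alpha : 'I_d -> R)
    (x : R) (n : nat) : R :=
  (-1) ^+ n / (n`!%:R * \prod_(i < d) pochhammer (alpha i + 1) n)
  * (x / d.+1%:R) ^+ (n * d.+1).

(* Normalized hyper-Bessel function, on the real line.  [limn] is a total
   operator; the series converges for every [x] as soon as all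
   [alpha i > -1]. *)
Definition hyper_bessel (R : realType) (d : nat) (alpha : 'I_d -> R)
    (x : R) : R :=
  limn (series (hyper_bessel_term alpha x)).

Definition smallest_pos_zero (R : realType) (f : R -> R) (z : R) : Prop :=
  [/\ 0 < z, f z = 0 & forall y : R, 0 < y -> f y = 0 -> z <= y].

(* j_{alpha,1}: *the* smallest positive zero (it is unique when it exists);
   [0] is a junk value, returned only if there is no such zero. *)
Definition hyper_bessel_zero1 (R : realType) (d : nat) (alpha : 'I_d -> R)
    : R :=
  xget 0 [set z | smallest_pos_zero (hyper_bessel alpha) z].

Definition redheffer_base (R : realType) (d : nat) (alpha : 'I_d -> R)
    (x : R) : R :=
  let j := hyper_bessel_zero1 alpha in
  (j ^+ d.+1 - x ^+ d.+1) / j ^+ d.+1.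

(* Main.v *)
(* In the variable t = (x / (d+1))^(d+1) the function becomes
   F(t) = \sum_n (-t)^n / (n! \prod_i (b_i)_n), with b_i = alpha_i + 1.
   Following Laguerre, F is a pointwise limit of polynomials
   P_N = \prod_k (1 - c_k X) with c_k >= 0: start from (1 - X/K)^N and apply
   the operators p |-> p + e X p' with e = 1 / (b_i + j), j < M; each of them
   keeps all complex zeros positive.  Writing m = max c_k and S = \sum c_k,
   Bernoulli's inequality on each factor gives
     (1 - m t)^(S/m) <= P_N(t) <= min (1 - m t, e^(- S t))  on [0, 1/m).
   As \sum c_k^2 <= m S, the coefficients of t and t^2 keep m away from 0, so a
   subsequence of the maxima converges to some m > 0.  In the limit 1/m is the
   smallest positive zero of F, S tends to 1 / \prod_i b_i, and the bounds become
   the two inequalities.  The bound F(t) <= e^(- S t) makes the left exponent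
   optimal.  Optimality of the right one says that 1/m is a simple zero of F: the
   last operator in the construction of P_N yields the uniform bound
   P_N(t) >= e^(- b_i) S / (1 + b_i) (1/m - t). *)

Require Import Defs.
From HB Require Import structures.
From mathcomp Require Import all_boot all_order all_algebra.
From mathcomp Require Import all_classical all_reals all_analysis.
From mathcomp Require Import complex ring lra.

Set Implicit Arguments.
Unset Strict Implicit.
Unset Printing Implicit Defensive.

Import Order.TTheory GRing.Theory Num.Theory.
Import numFieldNormedType.Exports.

Local Open Scope ring_scope.

(** * Real-rooted polynomials normalized at 0 *)

(** The list holds reciprocals of roots, so the value at 0 is 1 and an entry 0 is a harmless factor
    1. *)
Definition linprod (F : nzRingType) (s : seq F) : {poly F} :=
  \prod_(c <- s) (1 - c *: 'X).

(** This is 1 + e θ with the Euler operator θ = X d/dX; it is diagonal on monomials. *)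
Definition euler_step (F : nzRingType) (e : F) (p : {poly F}) : {poly F} :=
  p + e *: ('X * p^`()).

Lemma linprod_cons (F : nzRingType) (c : F) s :
  linprod (c :: s) = (1 - c *: 'X) * linprod s.
Proof. by rewrite /linprod big_cons. Qed.

Lemma horner_linprod (F : comNzRingType) (s : seq F) x :
  (linprod s).[x] = \prod_(c <- s) (1 - c * x).
Proof.
rewrite /linprod horner_prod; apply: eq_bigr => c _.
by rewrite !hornerE.
Qed.

Lemma linprod_coef0 (F : comNzRingType) (s : seq F) : (linprod s)`_0 = 1.
Proof.
rewrite -horner_coef0 horner_linprod big1_seq // => c _.
by rewrite mulr0 subr0.
Qed.

Lemma coef_linprod_cons (F : comNzRingType) (c : F) s n :
  (linprod (c :: s))`_n.+1 = (linprod s)`_n.+1 - c * (linprod s)`_n.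
Proof. by rewrite linprod_cons mulrBl mul1r coefB -scalerAl coefZ coefXM. Qed.

Lemma linprod_coef1 (F : comNzRingType) (s : seq F) :
  (linprod s)`_1 = - \sum_(c <- s) c.
Proof.
elim: s => [|c s ih]; first by rewrite /linprod !big_nil oppr0 coef1.
by rewrite coef_linprod_cons ih linprod_coef0 big_cons; ring.
Qed.

(** Newton's identity for the second power sum; it makes the sum of squares readable from the
    coefficients. *)
Lemma linprod_coef2 (F : comNzRingType) (s : seq F) :
  \sum_(c <- s) c ^+ 2 = (\sum_(c <- s) c) ^+ 2 - (linprod s)`_2 *+ 2.
Proof.
elim: s => [|c s ih]; first by rewrite /linprod !big_nil coef1 mul0rn expr0n subr0.
by rewrite coef_linprod_cons linprod_coef1 !big_cons ih; ring.
Qed.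

Lemma linprod_logderiv (F : fieldType) (s : seq F) z :
  (forall c, c \in s -> 1 - c * z != 0) ->
  z * (linprod s)^`().[z] =
    - ((linprod s).[z] * \sum_(c <- s) c * z / (1 - c * z)).
Proof.
elim: s => [|c s ih] hs; first
  by rewrite /linprod !big_nil -polyC1 derivC horner0 !mulr0 oppr0.
have hc : 1 - c * z != 0 by apply: hs; rewrite inE eqxx.
have {}ih : _ := ih (fun c' h => hs c' (@mem_behead _ (c :: s) c' h)).
rewrite linprod_cons derivM !hornerE big_cons.
rewrite derivB -polyC1 derivC derivZ derivX !hornerE.
set L' := (linprod s)^`().[z] in ih *.
transitivity (- c * z * (linprod s).[z] + (1 - c * z) * (z * L')); first ring.
by rewrite ih; field.
Qed.

Lemma coef_euler_step (F : comNzRingType) (e : F) (p : {poly F}) n :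
  (euler_step e p)`_n = p`_n * (1 + e * n%:R).
Proof.
rewrite /euler_step coefD coefZ coefXM coef_deriv.
case: n => [|n] /=; first by rewrite !mulr0 !addr0 mulr1.
by rewrite -[_ *+ _]mulr_natr mulrDr mulr1 mulrCA.
Qed.

Lemma horner_euler_step_linprod (F : fieldType) (e : F) (s : seq F) z :
  (forall c, c \in s -> 1 - c * z != 0) ->
  (euler_step e (linprod s)).[z] =
    (linprod s).[z] * (1 - e * \sum_(c <- s) c * z / (1 - c * z)).
Proof.
move=> hs; rewrite /euler_step hornerD hornerZ hornerM hornerX.
by rewrite linprod_logderiv //; ring.
Qed.

(* A root [z] off the zeros of [linprod s] satisfies
   [\sum_c c z / (1 - c z) = e^-1]; the imaginary part of the left-hand side is
   [Im z] times [\sum_c c / `|1 - c z|^2]. *)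
Lemma root_euler_step_linprod (C : numClosedFieldType) (s : seq C) e z :
  {in s, forall c, 0 <= c} -> 0 < e ->
  root (euler_step e (linprod s)) z -> 0 < z.
Proof.
move=> s0 e0; rewrite /root => /eqP rz.
have [/allP hs|] := boolP (all (fun c => 1 - c * z != 0) s); last first.
  (* If [z] is a zero of some factor, then [c * z = 1] with [c > 0], hence [z > 0]. *)
  case/allPn => c cs /negPn; rewrite subr_eq0 => /eqP cz.
  have c0 : c != 0 by apply: contra_eq_neq cz => ->; rewrite mul0r oner_neq0.
  rewrite -(@pmulr_rgt0 _ c) -?cz ?ltr01 //.
  by rewrite lt0r c0 s0.
have hP : (linprod s).[z] != 0.
  by rewrite horner_linprod prodf_seq_neq0; apply/allP => c /hs ->.
have hS : \sum_(c <- s) c * z / (1 - c * z) = e^-1.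
  move: rz; rewrite horner_euler_step_linprod // => /eqP.
  rewrite mulf_eq0 (negPf hP) /= subr_eq0 => /eqP h.
  have e1 : e != 0 by rewrite gt_eqF.
  by apply: (mulfI e1); rewrite -h mulfV.
have zR : z \is Num.real.
  rewrite CrealE; apply/negPn/negP => zz.
  have h : \sum_(c <- s) c * z / (1 - c * z) =
    (\sum_(c <- s) c * z / (1 - c * z))^*.
    by rewrite hS; apply/esym/CrealP; rewrite realE invr_ge0 (ltW e0).
  have {h} : (z - z^*) * \sum_(c <- s) c / `|1 - c * z| ^+ 2 = 0.
    rewrite mulr_sumr.
    move/eqP: h; rewrite -subr_eq0 rmorph_sum -sumrB => /eqP; apply: etrans.
    apply: eq_big_seq => c cs; rewrite normCK.
    have cR : c^* = c by apply/CrealP; rewrite realE s0.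
    have cz := hs c cs.
    have czC : 1 - c * z^* != 0.
      by rewrite -{1}cR -rmorphM -{1}(rmorph1 Num.conj) -rmorphB fmorph_eq0.
    rewrite fmorph_div !rmorphM !rmorphB !rmorph1 !rmorphM /= cR.
    by field; rewrite cz czC.
  move/eqP; rewrite mulf_eq0 subr_eq0 [z == _]eq_sym (negPf zz) /=.
  have sq c : c \in s -> 0 < `|1 - c * z| ^+ 2.
    by move=> /hs h; rewrite exprn_gt0 // normr_gt0.
  rewrite big_seq psumr_eq0 => [/allP h|c cs]; last first.
    by apply: divr_ge0; [exact: s0 | exact/ltW/sq].
  have : e^-1 = 0.
    rewrite -hS big1_seq // => c /= cs.
    move: (h c cs); rewrite cs mulf_eq0 invr_eq0 (gt_eqF (sq c cs)) orbF.
    by move=> /eqP ->; rewrite !mul0r.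
  by move/eqP; rewrite invr_eq0 gt_eqF.
(* For real [z <= 0] every term of the sum is nonpositive, whereas the sum is [e^-1 > 0]. *)
rewrite real_ltNge ?real0 //; apply/negP => z0.
have : e^-1 <= 0.
  rewrite -hS big_seq sumr_le0 // => c cs.
  have cz : c * z <= 0 by rewrite mulr_ge0_le0 ?s0.
  by rewrite mulr_le0_ge0 // invr_ge0 subr_ge0 (le_trans cz) ?ler01.
have ei0 : 0 < e^-1 by rewrite invr_gt0.
by move/(lt_le_trans ei0); rewrite ltxx.
Qed.

(** Over the complex closure the polynomial splits and all its roots are positive, hence real; their
    reciprocals form the new list. *)
Lemma euler_step_linprod (R : rcfType) (s : seq R) (e : R) :
  {in s, forall c, 0 <= c} -> 0 < e ->
  exists2 s' : seq R, {in s', forall c, 0 <= c} &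
    euler_step e (linprod s) = linprod s'.
Proof.
move=> s0 e0; set q := euler_step e (linprod s).
have q0 : q`_0 = 1 by rewrite coef_euler_step linprod_coef0 mulr0 addr0 mulr1.
pose f := real_complex R.
have qC : map_poly f q = euler_step (f e) (linprod (map f s)).
  rewrite /q /euler_step rmorphD /= map_polyZ rmorphM /= map_polyX -deriv_map.
  suff -> : map_poly f (linprod s) = linprod (map f s) by [].
  rewrite /linprod rmorph_prod /= big_map; apply: eq_bigr => c _.
  by rewrite rmorphB rmorph1 /= map_polyZ map_polyX.
have [zs qzs] := closed_field_poly_normal (map_poly f q).
have lq : lead_coef (map_poly f q) != 0.
  rewrite lead_coef_eq0 map_poly_eq0; apply/eqP => qz.
  by move: q0; rewrite qz coef0 => /esym/eqP; rewrite oner_eq0.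
have zs0 z : z \in zs -> 0 < z.
  move=> zzs; apply: (@root_euler_step_linprod _ (map f s) (f e)).
  - by move=> _ /mapP[c cs ->]; rewrite ler0c s0.
  - by rewrite ltcE /= eqxx.
  - by rewrite -qC qzs rootZ // root_prod_XsubC.
pose rs := map (@complex.Re R) zs.
have rsE : zs = map f rs.
  rewrite -map_comp -[LHS]map_id; apply/eq_in_map => z /zs0.
  by case: z => x y; rewrite ltcE /= => /andP[/eqP -> _].
have qE : q = lead_coef q *: \prod_(r <- rs) ('X - r%:P).
  apply: (map_poly_inj f); rewrite qzs lead_coef_map map_polyZ /=.
  rewrite rmorph_prod rsE big_map; congr (_ *: _); apply: eq_bigr => r _.
  by rewrite rmorphB /= map_polyX map_polyC.
have rs0 r : r \in rs -> 0 < r.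
  move=> rrs; have : 0 < f r by apply: zs0; rewrite rsE map_f.
  by rewrite ltcE => /andP[_].
exists [seq r^-1 | r <- rs].
  by move=> _ /mapP[r /rs0 r0 ->]; rewrite invr_ge0 ltW.
(* The value 1 at 0 converts the monic factors ['X - r] into the normalized [1 - r^-1 *: 'X]. *)
have l1 : lead_coef q * \prod_(r <- rs) - r = 1.
  transitivity q.[0]; last by rewrite horner_coef0.
  rewrite [in RHS]qE hornerZ horner_prod; congr (_ * _).
  by apply: eq_bigr => r _; rewrite !hornerE.
rewrite /linprod big_map.
rewrite [LHS](_ : _ = lead_coef q *: \prod_(r <- rs) ((- r) *: (1 - r^-1 *: 'X))).
  by rewrite scaler_prod scalerA l1 scale1r.
rewrite {1}qE; congr (_ *: _).
apply: eq_big_seq => r /rs0 r0; rewrite scalerBr scalerA mulNr divff ?gt_eqF //.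
by rewrite scaleN1r opprK scaleNr addrC alg_polyC.
Qed.

(** * Bounds for products of linear factors before the first zero *)

Lemma expR_ln_le_convex (R : realType) (u a : R) : 0 < u -> 0 <= a <= 1 ->
  expR (a * ln u) <= 1 - a + a * u.
Proof.
move=> u0 /andP[a0 a1].
set v := 1 - a + a * u.
have v0 : 0 < v.
  rewrite /v; have [->|an0] := eqVneq a 0; first by rewrite mul0r addr0 subr0.
  by rewrite ltr_wpDl ?subr_ge0 // mulr_gt0 // lt0r an0.
rewrite -[leRHS]lnK ?posrE // ler_expR.
have lnle (w : R) : 0 < w -> ln w <= w - 1.
  move=> w0; have := @le_ln1Dx R (w - 1).
  by rewrite (addrC 1) subrK; apply; rewrite ltrBrDl subrr.
(* The tangent of [ln] at [v] is used at [u] and at 1; with weights [a] and [1 - a] the right-hand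
   sides cancel. *)
have h1 : ln u - ln v <= u / v - 1.
  by rewrite -ln_div ?posrE // lnle // divr_gt0.
have h2 : - ln v <= v^-1 - 1 by rewrite -lnV ?posrE // lnle // invr_gt0.
have e : a * (u / v - 1) + (1 - a) * (v^-1 - 1) = 0.
  by rewrite /v; field; rewrite gt_eqF.
have := lerD (ler_wpM2l a0 h1) (ler_wpM2l (_ : 0 <= 1 - a) h2).
rewrite subr_ge0 e => /(_ a1); lra.
Qed.

Lemma ler_prod_seq (R : numDomainType) (I : eqType) (s : seq I) (f g : I -> R) :
  {in s, forall i, 0 <= f i <= g i} ->
  \prod_(i <- s) f i <= \prod_(i <- s) g i.
Proof. by move=> h; rewrite big_seq [leRHS]big_seq ler_prod. Qed.

Section LinprodBounds.
Variables (R : realType) (s : seq R) (m : R).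
Hypothesis s0 : {in s, forall c, 0 <= c}.
Hypothesis sm : {in s, forall c, c <= m}.
Hypothesis ms : m \in s.

Let m0 : 0 <= m. Proof. exact: s0. Qed.

Lemma linprod_factor_gt0 t : 0 <= t -> m * t < 1 ->
  {in s, forall c, 0 < 1 - c * t}.
Proof.
move=> t0 mt c cs; rewrite subr_gt0 (le_lt_trans _ mt) //.
by rewrite ler_wpM2r // sm.
Qed.

Lemma linprod_factor_ge0 t : 0 <= t -> m * t <= 1 ->
  {in s, forall c, 0 <= 1 - c * t}.
Proof.
move=> t0 mt c cs; rewrite subr_ge0 (le_trans _ mt) //.
by rewrite ler_wpM2r // sm.
Qed.

Lemma sum_ge0 : 0 <= \sum_(c <- s) c.
Proof. by rewrite big_seq sumr_ge0. Qed.

Lemma linprod_gt0 t : 0 <= t -> m * t < 1 -> 0 < (linprod s).[t].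
Proof.
move=> t0 mt; rewrite horner_linprod big_seq prodr_gt0 // => c cs.
exact: linprod_factor_gt0.
Qed.

(** Bernoulli with base [1 - m * t] and exponent [c / m] bounds the factor [1 - c * t]; the
    exponents add up. *)
Lemma linprod_ge_powR t : 0 < m -> 0 <= t -> m * t < 1 ->
  expR ((\sum_(c <- s) c) / m * ln (1 - m * t)) <= (linprod s).[t].
Proof.
move=> mp t0 mt; rewrite horner_linprod !mulr_suml expR_sum.
apply: ler_prod_seq => c cs; rewrite expR_ge0 /=.
apply: le_trans (expR_ln_le_convex _ _) _.
- by rewrite subr_gt0.
- by rewrite divr_ge0 ?s0 //= ler_pdivrMr // mul1r sm.
by rewrite le_eqVlt; apply/orP; left; apply/eqP; field; rewrite gt_eqF.
Qed.

Lemma linprod_le_expR t : 0 <= t -> m * t <= 1 ->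
  (linprod s).[t] <= expR (- (\sum_(c <- s) c) * t).
Proof.
move=> t0 mt; rewrite horner_linprod -sumrN mulr_suml expR_sum.
apply: ler_prod_seq => c cs; rewrite linprod_factor_ge0 //=.
by rewrite mulNr expR_ge1Dx.
Qed.

Let horner_linprod_rem t :
  (linprod s).[t] = (1 - m * t) * \prod_(c <- rem m s) (1 - c * t).
Proof. by rewrite horner_linprod (perm_big _ (perm_to_rem ms)) big_cons. Qed.

Lemma linprod_le_linear t : 0 <= t -> m * t <= 1 -> (linprod s).[t] <= 1 - m * t.
Proof.
move=> t0 mt; rewrite horner_linprod_rem ler_piMr ?subr_ge0 //.
rewrite big_seq numdomain.Num.Theory.prodr_ile1 // => c /mem_rem cs.
by rewrite linprod_factor_ge0 //= gerBl mulr_ge0 ?(s0 cs).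
Qed.

(** No upper limit is put on [t]: this is applied at the limit of the first zeros, which may lie
    beyond the first zero of an approximant. *)
Lemma normr_linprod_le t : 0 <= t ->
  `|(linprod s).[t]| <= `|1 - m * t| * expR ((\sum_(c <- s) c) * t).
Proof.
move=> t0; rewrite horner_linprod_rem normrM ler_wpM2l //.
rewrite (perm_big _ (perm_to_rem ms)) big_cons.
apply: (@le_trans _ _ (expR ((\sum_(c <- rem m s) c) * t))); last first.
  by rewrite ler_expR ler_wpM2r // lerDr.
rewrite mulr_suml expR_sum normr_prod.
apply: ler_prod_seq => c /mem_rem cs; rewrite normr_ge0 /=.
apply: le_trans (ler_normB _ _) _.
by rewrite normr1 ger0_norm ?mulr_ge0 ?(s0 cs) ?expR_ge1Dx.
Qed.

Lemma sum_sqr_le : \sum_(c <- s) c ^+ 2 <= m * \sum_(c <- s) c.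
Proof.
rewrite mulr_sumr big_seq [leRHS]big_seq ler_sum // => c cs.
by rewrite expr2 ler_wpM2r ?s0 ?sm.
Qed.

Lemma max_le_sum : m <= \sum_(c <- s) c.
Proof.
rewrite (perm_big _ (perm_to_rem ms)) big_cons lerDl big_seq sumr_ge0 //.
by move=> c /mem_rem/s0.
Qed.

End LinprodBounds.

Lemma exists_max_seq (R : realDomainType) (s : seq R) : s != [::] ->
  exists2 m, m \in s & {in s, forall c, c <= m}.
Proof.
elim: s => // c [|c' s] ih _.
  by exists c; rewrite ?inE // => x; rewrite inE => /eqP ->.
have [//|m ms mP] := ih.
have [cm|mc] := leP c m.
- by exists m; rewrite 1?inE ?ms ?orbT // => x; rewrite inE => /predU1P[->|/mP].
- exists c; rewrite ?inE ?eqxx // => x; rewrite inE => /predU1P[->//|/mP xm].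
  exact: le_trans xm (ltW mc).
Qed.

(** * A linear lower bound up to the first zero, from the last operator *)

Section EulerStepLowerBound.
Variables (R : realType) (s s' : seq R) (m c : R).
Hypothesis s0 : {in s, forall x, 0 <= x}.
Hypothesis s0' : {in s', forall x, 0 <= x}.
Hypothesis sm : {in s, forall x, x <= m}.
Hypothesis ms : m \in s.
Hypothesis m0 : 0 < m.
Hypothesis c0 : 0 < c.
Hypothesis ss' : linprod s = euler_step c^-1 (linprod s').

(** Minus [t] times the logarithmic derivative of [linprod s']; zeros of [linprod s] before those of
    [linprod s'] are the points where it equals [c]. *)
Let u t := \sum_(x <- s') x * t / (1 - x * t).

Let sumE : \sum_(x <- s) x = (\sum_(x <- s') x) * (1 + c^-1).
Proof.
have := linprod_coef1 s; rewrite ss' coef_euler_step linprod_coef1 mulr1.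
by rewrite mulNr => /oppr_inj.
Qed.

Let horner_s t : {in s', forall x, 0 < 1 - x * t} ->
  (linprod s).[t] = (linprod s').[t] * (1 - c^-1 * u t).
Proof.
move=> h; rewrite ss' horner_euler_step_linprod // => x /h.
by move/lt0r_neq0.
Qed.

(* Before reaching the first zero [x^-1] of [linprod s'], the sum [u] exceeds
   [c], so that [linprod s] vanishes strictly earlier. *)
Let factor_gt0 t : 0 <= t <= m^-1 -> {in s', forall x, 0 < 1 - x * t}.
Proof.
move=> /andP[t0 tm] x xs; rewrite ltNge; apply/negP; rewrite subr_le0 => xt.
have [|m' ms' mP'] := @exists_max_seq R s'; first by case: (s') xs.
have m't : 1 <= m' / m.
  apply: (le_trans xt); apply: ler_pM => //; [exact: s0'|exact: mP'].
have m'0 : 0 < m'.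
  by rewrite -(pmulr_lgt0 m' (_ : 0 < m^-1)) ?invr_gt0 // (lt_le_trans ltr01).
(* Chosen so that the term of [m'] alone equals [c] at [v]; then [u v >= c], although [linprod s] is
   still positive at [v]. *)
pose v := c / (1 + c) / m'.
have c1 : 0 < 1 + c by rewrite addr_gt0.
have m'v : m' * v = c / (1 + c) by rewrite /v; field; rewrite !gt_eqF.
have m'v1 : m' * v < 1 by rewrite m'v ltr_pdivrMr // mul1r ltrDr.
have v0 : 0 <= v by rewrite !divr_ge0 // ltW.
have mv : m * v < 1.
  apply: le_lt_trans m'v1; rewrite ler_wpM2r //.
  by rewrite -(mul1r m) -ler_pdivlMr.
have fv := linprod_factor_gt0 mP' v0 m'v1.
have Q0 : 0 < (linprod s').[v] := linprod_gt0 mP' v0 m'v1.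
have := linprod_gt0 sm v0 mv.
rewrite horner_s // (pmulr_rgt0 _ Q0).
apply/negP; rewrite -leNgt subr_le0 mulrC ler_pdivlMr // mul1r.
rewrite /u (perm_big _ (perm_to_rem ms')) big_cons m'v.
have -> : c / (1 + c) / (1 - c / (1 + c)) = c.
  by field; rewrite gt_eqF //= addrK oner_neq0.
rewrite lerDl big_seq sumr_ge0 // => y /mem_rem ys.
by apply: divr_ge0; [rewrite mulr_ge0 ?(s0' ys)|exact/ltW/fv].
Qed.

(** Write P = Q (1 - u/c), with P and Q the products over [s] and [s']. Since u(1/m) = c and u grows
    at least at rate S' (the sum of [s']), c - u(t) >= S' (1/m - t), while Q(t) >= e^(-u(t)) >=
    e^(-c). Finally S'/c = S/(1 + c), with S the sum of [s]. *)
Lemma euler_step_linprod_ge t : 0 <= t <= m^-1 ->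
  expR (- c) * ((\sum_(x <- s) x) / (1 + c)) * (m^-1 - t) <= (linprod s).[t].
Proof.
move=> tm; have /andP[t0 tm'] := tm.
have ft := factor_gt0 tm.
have fm : {in s', forall x, 0 < 1 - x * m^-1}.
  by apply: factor_gt0; rewrite lexx invr_ge0 ltW.
have Pm : (linprod s).[m^-1] = 0.
  rewrite horner_linprod (perm_big _ (perm_to_rem ms)) big_cons divff ?gt_eqF //.
  by rewrite subrr /= mul0r.
have Q0 (r : R) : {in s', forall x, 0 < 1 - x * r} -> 0 < (linprod s').[r].
  by move=> h; rewrite horner_linprod big_seq prodr_gt0.
have um : u m^-1 = c.
  move: Pm; rewrite horner_s // => /eqP; rewrite mulf_eq0 gt_eqF ?Q0 //=.
  by rewrite subr_eq0 => /eqP h; rewrite -[c]mulr1 h mulVKf ?gt_eqF.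
have du : (\sum_(x <- s') x) * (m^-1 - t) <= c - u t.
  rewrite -um /u -sumrB mulr_suml big_seq [leRHS]big_seq ler_sum // => x xs.
  have fx := fm x xs; have fx' := ft x xs.
  (* Both factors in the resulting denominator lie in (0, 1], so dropping it gives a lower bound. *)
  have -> : x / m / (1 - x / m) - x * t / (1 - x * t) =
      x * (m^-1 - t) / ((1 - x / m) * (1 - x * t)).
    field; rewrite !gt_eqF //= subr_gt0 -[m]mul1r -ltr_pdivrMr //.
    by rewrite -subr_gt0.
  rewrite ler_pdivlMr ?mulr_gt0 // ler_piMr ?mulr_ge0 ?(s0' xs) ?subr_ge0 //.
  rewrite mulr_ile1 ?(ltW fx) ?(ltW fx') // gerBl mulr_ge0 ?(s0' xs) //.
  by rewrite invr_ge0 ltW.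
have uc : u t <= c.
  rewrite -subr_ge0; apply: le_trans du.
  by rewrite mulr_ge0 ?subr_ge0 // sum_ge0.
have Qt : expR (- c) <= (linprod s').[t].
  apply: (@le_trans _ _ (expR (- u t))); first by rewrite ler_expR lerN2.
  (* Factor by factor, 1/(1 - xt) = 1 + xt/(1 - xt) <= e^(xt/(1 - xt)). *)
  rewrite /u -sumrN expR_sum horner_linprod.
  apply: ler_prod_seq => x xs; rewrite expR_ge0 /=.
  rewrite expRN invf_ple ?posrE ?expR_gt0 ?ft //.
  apply: le_trans (expR_ge1Dx _).
  by rewrite le_eqVlt; apply/orP; left; apply/eqP; field; rewrite gt_eqF ?ft.
rewrite horner_s // sumE.
apply: (@le_trans _ _ (expR (- c) * (1 - c^-1 * u t))); last first.
  by rewrite ler_wpM2r // subr_ge0 mulrC ler_pdivrMr // mul1r.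
rewrite -mulrA ler_wpM2l ?expR_ge0 //.
rewrite [leLHS](_ : _ = c^-1 * ((\sum_(x <- s') x) * (m^-1 - t))); last first.
  by field; rewrite !gt_eqF // addr_gt0.
rewrite [leRHS](_ : _ = c^-1 * (c - u t)); last by field; rewrite gt_eqF.
by rewrite ler_wpM2l // invr_ge0 ltW.
Qed.

End EulerStepLowerBound.

(** * Polynomial approximation of the hyper-Bessel series *)

Lemma coef_linprod_nseq (R : comNzRingType) (a : R) N n :
  (linprod (nseq N a))`_n = 'C(N, n)%:R * (- a) ^+ n.
Proof.
elim: N n => [|N ih] [|n] //=.
- by rewrite linprod_coef0 bin0 expr0 mulr1.
- by rewrite /linprod big_nil coef1 bin0n mul0r.
- by rewrite linprod_coef0 bin0 expr0 mulr1.
by rewrite coef_linprod_cons !ih binS natrD exprS; ring.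
Qed.

Lemma iter_euler_step_linprod (R : rcfType) (s cs : seq R) :
  {in s, forall c, 0 <= c} -> {in cs, forall c, 0 < c} ->
  exists2 s' : seq R, {in s', forall c, 0 <= c} &
    forall n, (linprod s')`_n =
      (linprod s)`_n * \prod_(c <- cs) (1 + c^-1 * n%:R).
Proof.
move=> s0; elim: cs => [|c cs ih] cs0.
  by exists s => // n; rewrite big_nil mulr1.
have [|s' s'0 s'E] := ih; first by move=> x xs; apply: cs0; rewrite inE xs orbT.
have [|s'' s''0 s''E] := @euler_step_linprod _ s' c^-1 s'0.
  by rewrite invr_gt0 cs0 ?inE ?eqxx.
exists s'' => // n; rewrite -s''E coef_euler_step s'E big_cons.
by rewrite -mulrA [X in _ * X]mulrC.
Qed.

Lemma pochhammer_gt0 (R : realType) (b : R) n : 0 < b -> 0 < pochhammer b n.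
Proof. by move=> b0; apply: prodr_gt0 => k _; rewrite ltr_wpDr. Qed.

Lemma pochhammerD (R : realType) (b : R) m n :
  pochhammer b (m + n) = pochhammer b m * pochhammer (b + m%:R) n.
Proof.
rewrite /pochhammer big_split_ord; congr (_ * _).
by apply: eq_bigr => k _; rewrite /= natrD addrA.
Qed.

(** Splitting (b)_(m+n) in two ways gives (b)_m (b+m)_n = (b)_n (b+n)_m. This is how the operators
    create the denominators (b)_n. *)
Lemma prod_shift_pochhammer (R : realType) (b : R) m n : 0 < b ->
  \prod_(k < m) (1 + (b + k%:R)^-1 * n%:R) =
    pochhammer (b + m%:R) n / pochhammer b n.
Proof.
move=> b0; have bp p : pochhammer b p != 0 by rewrite gt_eqF ?pochhammer_gt0.
have -> : \prod_(k < m) (1 + (b + k%:R)^-1 * n%:R) =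
    pochhammer (b + n%:R) m / pochhammer b m.
  rewrite /pochhammer -prodf_div; apply: eq_bigr => k _.
  by field; rewrite gt_eqF // ltr_wpDr.
apply/eqP; rewrite eqr_div // mulrC -pochhammerD addnC pochhammerD mulrC.
by rewrite eqxx.
Qed.

(** For [n > N.+1] both sides vanish, the right one through the factor [k = N.+1]. *)
Lemma natr_ffact (R : realFieldType) N n :
  (N.+1 ^_ n)%:R = N.+1%:R ^+ n * \prod_(k < n) (1 - k%:R / N.+1%:R) :> R.
Proof.
have [nN|Nn] := leqP n N.+1; last first.
  rewrite ffact_small // (bigD1 (Ordinal Nn)) //= divff ?pnatr_eq0 //.
  by rewrite subrr mul0r mulr0.
elim: n nN => [|n ih] nN; first by rewrite big_ord0 mulr1.
rewrite ffactnSr natrM ih 1?ltnW // big_ord_recr exprSr /= -!mulrA.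
congr (_ * _); rewrite [RHS]mulrCA; congr (_ * _).
rewrite natrB 1?ltnW // mulrBr mulr1 mulrCA divff ?mulr1 // pnatr_eq0.
Qed.

(* Ratio of the degree [n] coefficients of the [N]-th approximant and of the
   series.  The approximant has degree [N.+1], uses the first [M = N.+1 ^ 2]
   operators for each parameter, and is scaled by
   [K = N.+1 * \prod_i (b i + M + N.+1)], which makes the ratio at most [1]. *)
Definition laguerre_weight (R : realType) d (b : 'I_d -> R) N n : R :=
  \prod_(k < n) (1 - k%:R / N.+1%:R) *
  \prod_(i < d) \prod_(k < n)
    ((b i + (N.+1 ^ 2)%:R + k%:R) / (b i + (N.+1 ^ 2)%:R + N.+1%:R)).

(* Coefficients of the hyper-Bessel series in the variable
   [t = (x / d.+1) ^+ d.+1], with [b i = alpha i + 1]. *)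
Definition hb_coef (R : realType) d (b : 'I_d -> R) n : R :=
  (-1) ^+ n / (n`!%:R * \prod_(i < d) pochhammer (b i) n).

(** The operators commute, so the one with parameter [b i0] can be applied last; [s'] records the
    stage before it, as the linear lower bound requires. *)
Lemma hyper_bessel_approximant (R : realType) d (b : 'I_d -> R) (i0 : 'I_d) N :
  (forall i, 0 < b i) ->
  exists s s' : seq R,
    [/\ {in s, forall c, 0 <= c}, {in s', forall c, 0 <= c},
       linprod s = euler_step (b i0)^-1 (linprod s') &
       forall n, (linprod s)`_n = laguerre_weight b N n * hb_coef b n].
Proof.
move=> b0.
pose M := (N.+1 ^ 2)%N.
have bM0 i : 0 < b i + M%:R + N.+1%:R by rewrite !addr_gt0 ?ltr0n.
pose K := N.+1%:R * \prod_(i < d) (b i + M%:R + N.+1%:R).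
have K0 : 0 < K by rewrite mulr_gt0 ?ltr0n // prodr_gt0.
pose cs := [seq b i + k%:R | i <- enum 'I_d, k <- iota 0 M].
have cs0 : {in cs, forall c, 0 < c}.
  by move=> _ /allpairsP[[i k] [_ _ ->]] /=; rewrite ltr_wpDr.
have bcs : b i0 \in cs.
  apply/allpairsP; exists (i0, 0%N); split=> //=; rewrite ?mem_enum ?addr0 //.
have bs0 : {in nseq N.+1 K^-1, forall c, 0 <= c}.
  by move=> c /nseqP[-> _]; rewrite invr_ge0 ltW.
(* One occurrence of [b i0] is held back for the final operator. *)
have [|s' s'0 s'E] := @iter_euler_step_linprod _ _ (rem (b i0) cs) bs0.
  by move=> x /mem_rem; apply: cs0.
have [|s s_ge0 sE] := @euler_step_linprod _ s' (b i0)^-1 s'0.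
  by rewrite invr_gt0.
exists s, s'; split=> // n.
rewrite -sE coef_euler_step s'E -mulrA [X in _ * X]mulrC.
have -> : (1 + (b i0)^-1 * n%:R) * \prod_(c <- rem (b i0) cs) (1 + c^-1 * n%:R)
    = \prod_(c <- cs) (1 + c^-1 * n%:R).
  by rewrite [RHS](perm_big _ (perm_to_rem bcs)) big_cons.
have shift i : \prod_(k <- iota 0 M) (1 + (b i + k%:R)^-1 * n%:R) =
    pochhammer (b i + M%:R) n / pochhammer (b i) n.
  by rewrite -prod_shift_pochhammer // -(big_mkord xpredT
    (fun k => 1 + (b i + k%:R)^-1 * n%:R)) /index_iota subn0.
rewrite coef_linprod_nseq /cs big_allpairs_dep big_enum.
under eq_bigr => i _ do rewrite shift.
rewrite /laguerre_weight /hb_coef -/M.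
have -> : \prod_(i < d) \prod_(k < n)
      ((b i + M%:R + k%:R) / (b i + M%:R + N.+1%:R)) =
    (\prod_(i < d) pochhammer (b i + M%:R) n) /
    (\prod_(i < d) (b i + M%:R + N.+1%:R)) ^+ n.
  rewrite -prodrXl -prodf_div; apply: eq_bigr => i _.
  by rewrite prodf_div prodr_const card_ord.
rewrite prodf_div.
have nf : n`!%:R != 0 :> R by rewrite pnatr_eq0 -lt0n fact_gt0.
have Ce : 'C(N.+1, n)%:R =
    N.+1%:R ^+ n * \prod_(k < n) (1 - k%:R / N.+1%:R) / n`!%:R :> R.
  by rewrite -natr_ffact -bin_ffact natrM mulfK.
have p0 : \prod_(i < d) pochhammer (b i) n != 0.
  by rewrite gt_eqF // prodr_gt0 // => i _; apply: pochhammer_gt0.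
have P0 : \prod_(i < d) (b i + M%:R + N.+1%:R) != 0 by rewrite gt_eqF // prodr_gt0.
have Ke : (- K^-1) ^+ n = (-1) ^+ n /
    (N.+1%:R ^+ n * (\prod_(i < d) (b i + M%:R + N.+1%:R)) ^+ n).
  by rewrite [LHS]exprNn exprVn exprMn.
rewrite Ce Ke.
set X := \prod_(k < n) _; set Y := \prod_(i < d) pochhammer (b i + _) n.
field.
by apply/and4P; split=> //; rewrite expf_neq0 // pnatr_eq0.
Qed.

(** Up to [n = N.+1] every factor lies in [0, 1]; beyond that some factors may be negative, but the
    one at [k = N.+1] is 0. *)
Lemma laguerre_weight_itv (R : realType) d (b : 'I_d -> R) N n :
  (forall i, 0 < b i) -> 0 <= laguerre_weight b N n <= 1.
Proof.
move=> b0; rewrite /laguerre_weight.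
have [nN|Nn] := leqP n N.+1; last first.
  by rewrite (bigD1 (Ordinal Nn)) //= divff ?pnatr_eq0 // subrr !mul0r lexx ler01.
have kN (k : 'I_n) : k%:R <= N.+1%:R :> R.
  by rewrite ler_nat (leq_trans _ nN) // ltnW.
have h1 (k : 'I_n) : 0 <= (1 - k%:R / N.+1%:R : R) <= 1.
  rewrite subr_ge0 ler_pdivrMr ?ltr0n // mul1r kN /= gerBl.
  by rewrite divr_ge0.
have h2 i (k : 'I_n) : 0 <= (b i + (N.+1 ^ 2)%:R + k%:R) /
    (b i + (N.+1 ^ 2)%:R + N.+1%:R) <= 1.
  have D0 : 0 < b i + (N.+1 ^ 2)%:R + N.+1%:R by rewrite !addr_gt0 ?ltr0n.
  rewrite ler_pdivrMr // mul1r lerD2l kN andbT divr_ge0 //; last exact: ltW.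
  by rewrite !addr_ge0 // ltW.
apply/andP; split.
- rewrite mulr_ge0 ?prodr_ge0 // => [k _|i _]; first by case/andP: (h1 k).
  by apply: prodr_ge0 => k _; case/andP: (h2 i k).
- rewrite mulr_ile1 ?prodr_ge0 //.
  + by move=> k _; case/andP: (h1 k).
  + by move=> i _; apply: prodr_ge0 => k _; case/andP: (h2 i k).
  + exact: numdomain.Num.Theory.prodr_ile1.
  + apply: numdomain.Num.Theory.prodr_ile1 => i _.
    rewrite numdomain.Num.Theory.prodr_ile1 ?andbT //.
    by apply: prodr_ge0 => k _; case/andP: (h2 i k).
Qed.

Lemma laguerre_weight0 (R : realType) d (b : 'I_d -> R) N n :
  (N.+1 < n)%N -> laguerre_weight b N n = 0.
Proof.
move=> Nn; rewrite /laguerre_weight (bigD1 (Ordinal Nn)) //=.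
by rewrite divff ?pnatr_eq0 // subrr !mul0r.
Qed.

Local Open Scope classical_set_scope.

Lemma cvg_prod1 (R : realType) (T I : Type) (F : set_system T) {FF : Filter F}
    (r : seq I) (f : I -> T -> R) :
  (forall i, f i x @[x --> F] --> (1 : R)) ->
  \prod_(i <- r) f i x @[x --> F] --> (1 : R).
Proof.
move=> fl; elim: r => [|i r ih].
  by under eq_fun do rewrite big_nil; exact: cvg_cst.
under eq_fun do rewrite big_cons.
by have /(_ FF) := cvgM (fl i) ih; rewrite mulr1.
Qed.

(** The number of operators is quadratic in [N], so it dominates the shift [N.+1] in the
    denominators. *)
Lemma cvg_laguerre_weight (R : realType) d (b : 'I_d -> R) n :
  (forall i, 0 < b i) -> laguerre_weight b N n @[N --> \oo] --> (1 : R).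
Proof.
move=> b0.
have hN (k : R) : k / N.+1%:R @[N --> \oo] --> (0 : R).
  rewrite -[X in _ --> X](mulr0 k); apply: cvgM; first exact: cvg_cst.
  exact: cvg_harmonic.
rewrite -[X in _ --> X]mulr1; apply: cvgM.
  apply: cvg_prod1 => k; rewrite -[X in _ --> X]subr0.
  by apply: cvgB; [exact: cvg_cst|exact: hN].
apply: cvg_prod1 => i.
apply: cvg_prod1 => k.
apply: (@squeeze_cvgr _ _ _ _ (fun N => 1 - 1 / N.+1%:R)
  (fun N => 1 + k%:R / N.+1%:R)).
- apply: nearW => N.
  have D0 : 0 < b i + (N.+1 ^ 2)%:R + N.+1%:R by rewrite !addr_gt0 ?ltr0n.
  have N0 : 0 < N.+1%:R :> R by rewrite ltr0n.
  have b1 := ltW (b0 i); have k0 : 0 <= k%:R :> R by [].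
  rewrite ler_pdivlMr // ler_pdivrMr //.
  rewrite natrX in D0 *.
  set p := N.+1%:R in D0 N0 *; set q := k%:R in k0 *.
  have p0 : p != 0 by rewrite gt_eqF.
  have -> : (1 - 1 / p) * (b i + p ^+ 2 + p) = b i + p ^+ 2 - 1 - b i / p.
    by field.
  have -> : (1 + q / p) * (b i + p ^+ 2 + p) =
     b i + p ^+ 2 + p + q * b i / p + q * p + q by field.
  have h1 : 0 <= b i / p by rewrite divr_ge0 // ltW.
  have h2 : 0 <= q * b i / p by rewrite divr_ge0 ?mulr_ge0 // ltW.
  have h3 : 0 <= q * p by rewrite mulr_ge0 // ltW.
  by clearbody p q; apply/andP; split; lra.
- rewrite -[X in _ --> X]subr0.
  by apply: cvgB; [exact: cvg_cst|exact: hN].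
- rewrite -[X in _ --> X]addr0.
  by apply: cvgD; [exact: cvg_cst|exact: hN].
Qed.

Lemma cvg_sum0 (R : realType) (T I : Type) (F : set_system T) {FF : Filter F}
    (r : seq I) (f : I -> T -> R) :
  (forall i, f i x @[x --> F] --> (0 : R)) ->
  \sum_(i <- r) f i x @[x --> F] --> (0 : R).
Proof.
move=> fl; elim: r => [|i r ih].
  by under eq_fun do rewrite big_nil; exact: cvg_cst.
under eq_fun do rewrite big_cons.
by have /(_ FF) := cvgD (fl i) ih; rewrite addr0.
Qed.

(** Tannery's theorem: past [n0] the error is at most a tail of the absolute series, and before [n0]
    it is a finite sum of null sequences. *)
Lemma cvg_dominated_series (R : realType) (a : R^nat) (w : nat -> R^nat)
    (K : nat -> nat) :
  cvgn (series (fun n => `|a n|)) ->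
  (forall N n, 0 <= w N n <= 1) ->
  (forall n, w N n @[N --> \oo] --> (1 : R)) ->
  (forall N n, (K N <= n)%N -> w N n = 0) ->
  \sum_(0 <= n < K N) w N n * a n @[N --> \oo] --> limn (series a).
Proof.
move=> ca w01 w1 wK; apply/cvgrPdist_le => e e0.
set A := series (fun n => `|a n|) in ca *.
have e2 : 0 < e / 2 by rewrite divr_gt0.
have ndA : nondecreasing_seq A.
  by apply/nondecreasing_seqP => n; rewrite /A /series /= big_nat_recr //= lerDl.
have [n0 _ /(_ n0 (leqnn _)) /= hn0] := (cvgrPdist_lt _ _).1 ca _ e2.
have An0 L : A L - A n0 <= e / 2.
  apply: le_trans (ltW hn0); rewrite ger0_norm ?subr_ge0 ?lerD2r;
    exact: nondecreasing_cvgn_le.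
have h0 : \sum_(0 <= n < n0) (1 - w N n) * `|a n| @[N --> \oo] --> (0 : R).
  apply: cvg_sum0 => n.
  rewrite -[X in _ --> X](mul0r `|a n|); apply: cvgMr_tmp.
  rewrite -[X in _ --> X](subrr (1 : R)); apply: cvgB; [exact: cvg_cst|exact: w1].
near=> N.
have hN : `|\sum_(0 <= n < n0) (1 - w N n) * `|a n| | <= e / 2.
  by rewrite -normrN -sub0r; near: N; exact: (cvgrPdist_le _ _).1 h0 _ e2.
have ca' : cvgn (series a) by apply: normed_cvg.
set u := \sum_(0 <= n < K N) _.
have : `|series a L - u| @[L --> \oo] --> `|limn (series a) - u|.
  by apply: cvg_norm; apply: cvgB => //; exact: cvg_cst.
move=> hl; apply: (ler_cvg_to hl (cvg_cst e)).
exists (maxn n0 (K N)) => // L /=; rewrite geq_max => /andP[n0L KL].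
(* The weights vanish from [K N] on, so both sums can be cut at the same [L]. *)
have -> : u = \sum_(0 <= n < L) w N n * a n.
  rewrite [RHS](@big_cat_nat _ _ _ (K N)) //= [X in _ + X]big1_seq ?addr0 //.
  by move=> n /=; rewrite mem_index_iota => /andP[/wK -> _]; rewrite mul0r.
rewrite /series /= -sumrB.
have w1' n : 0 <= 1 - w N n <= 1.
  by rewrite subr_ge0 gerBl andbC; apply: w01.
apply: le_trans (ler_norm_sum _ _ _) _.
rewrite (@big_cat_nat _ _ _ n0) //=.
rewrite [leRHS](splitr e); apply: lerD.
  apply: le_trans (le_trans (ler_norm _) hN).
  apply: ler_sum => n _; rewrite -{1}[a n]mul1r -mulrBl normrM.
  by rewrite ger0_norm //; case/andP: (w1' n).
apply: le_trans (An0 L); rewrite /A /series /=.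
rewrite [X in X - _](@big_cat_nat _ _ _ n0) //=.
rewrite addrAC subrr add0r; apply: ler_sum => n _.
rewrite -{1}[a n]mul1r -mulrBl normrM ler_piMl //.
by rewrite ger0_norm; case/andP: (w1' n).
Unshelve. all: by end_near.
Qed.

(** All factors after the first are at least 1. The bound is uniform in [n], which allows comparison
    with the exponential series. *)
Lemma pochhammer_ge (R : realType) (b : R) n : 0 < b ->
  Num.min 1 b <= pochhammer b n.
Proof.
move=> b0; rewrite /pochhammer; case: n => [|n].
  by rewrite big_ord0 ge_min lexx.
rewrite ge_min; apply/orP; right; elim: n => [|n ih].
  by rewrite big_ord_recr big_ord0 /= mul1r addr0.
rewrite big_ord_recr /=; apply: le_trans ih _; rewrite ler_peMr //.
  by apply: prodr_ge0 => k _; rewrite addr_ge0 // ltW.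
by rewrite -natr1 addrA lerDr addr_ge0 // ltW.
Qed.

Lemma is_cvg_norm_hb_series (R : realType) d (b : 'I_d -> R) (t : R) :
  (forall i, 0 < b i) -> cvgn (series (fun n => `|hb_coef b n * t ^+ n|)).
Proof.
move=> b0; pose C := \prod_(i < d) Num.min 1 (b i).
have C0 : 0 < C by apply: prodr_gt0 => i _; rewrite lt_min ltr01 b0.
apply: (@series_le_cvg _ _ (fun n => C^-1 * exp_coeff `|t| n)).
- by [].
- move=> n; rewrite mulr_ge0 ?invr_ge0 ?(ltW C0) // /exp_coeff.
  by rewrite divr_ge0 ?exprn_ge0.
- move=> n; rewrite normrM /hb_coef normrM normrX normrN1 expr1n mul1r normrX.
  rewrite ger0_norm; last first.
    rewrite invr_ge0 mulr_ge0 // prodr_ge0 // => i _.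
    exact/ltW/pochhammer_gt0.
  rewrite invfM mulrAC mulrC /exp_coeff [n`!%:R^-1 * _]mulrC /=.
  rewrite ler_wpM2r ?divr_ge0 ?exprn_ge0 // lef_pV2 ?posrE //; last first.
    by apply: prodr_gt0 => i _; exact: pochhammer_gt0.
  apply: ler_prod => i _; rewrite pochhammer_ge // andbT.
  by rewrite le_min ler01 ltW.
- rewrite [X in cvgn X](_ : _ = C^-1 *: series (exp_coeff `|t|)).
    by apply: is_cvgZl_tmp; exact: is_cvg_series_exp_coeff.
  by apply/funext => n; rewrite /series /= -mulr_sumr.
Qed.

Lemma cvg_hyper_bessel_approximant (R : realType) d (b : 'I_d -> R)
    (p : nat -> {poly R}) (t : R) :
  (forall i, 0 < b i) ->
  (forall N n, (p N)`_n = laguerre_weight b N n * hb_coef b n) ->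
  (p N).[t] @[N --> \oo] --> limn (series (fun n => hb_coef b n * t ^+ n)).
Proof.
move=> b0 pE.
have pN N : (p N).[t] =
    \sum_(0 <= n < N.+2) laguerre_weight b N n * (hb_coef b n * t ^+ n).
  rewrite (@horner_coef_wide _ N.+2).
    by rewrite big_mkord; apply: eq_bigr => n _; rewrite pE mulrA.
  apply/leq_sizeP => n Nn; rewrite pE laguerre_weight0 ?mul0r //.
under eq_fun do rewrite pN.
apply: (@cvg_dominated_series _ _ (laguerre_weight b) (fun N => N.+2)).
- exact: is_cvg_norm_hb_series.
- by move=> N n; exact: laguerre_weight_itv.
- by move=> n; exact: cvg_laguerre_weight.
- by move=> N n; exact: laguerre_weight0.
Qed.

(** * The first zero *)

Lemma increasing_seq_cvgn (f : nat -> nat) :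
  increasing_seq f -> f n @[n --> \oo] --> \oo.
Proof.
move=> fi; have fge n : (n <= f n)%N.
  elim: n => // n ih; apply: (leq_ltn_trans ih).
  by rewrite ltnNge; have := fi n.+1 n; rewrite leEnat => ->; rewrite ltnn.
by move=> X [k _ kX]; exists k => // n /= kn; apply: kX => /=; exact: leq_trans kn _.
Qed.

Lemma hb_coef1 (R : realType) d (b : 'I_d -> R) :
  hb_coef b 1 = - (\prod_(i < d) b i)^-1.
Proof.
rewrite /hb_coef expr1 mul1r mulN1r; congr (- _^-1).
by apply: eq_bigr => i _; rewrite /pochhammer big_ord1 addr0.
Qed.

Lemma hb_coef2 (R : realType) d (b : 'I_d -> R) :
  hb_coef b 2 = (2 * (\prod_(i < d) b i * \prod_(i < d) (b i + 1)))^-1.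
Proof.
rewrite /hb_coef sqrrN expr1n mul1r; congr ((_ * _)^-1).
rewrite -big_split /=; apply: eq_bigr => i _.
by rewrite /pochhammer big_ord_recr big_ord1 /= addr0.
Qed.

Section FirstZero.
Variables (R : realType) (d : nat) (b : 'I_d -> R).
Hypothesis d0 : (0 < d)%N.
Hypothesis b0 : forall i, 0 < b i.

Let P := \prod_(i < d) b i.
Let F t := limn (series (fun n => hb_coef b n * t ^+ n)).

Let P0 : 0 < P. Proof. exact: prodr_gt0. Qed.

(** The strictness, which needs [d > 0], is what keeps the limit of the maxima positive. *)
Lemma ltr_prod_shift : P < \prod_(i < d) (b i + 1).
Proof.
case: d d0 b b0 @P => // n _ c c0 P'.
apply: ltr_prod; first by apply/hasP; exists ord0; rewrite ?mem_index_enum.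
by move=> i _; rewrite ltW ?c0 //= ltrDl.
Qed.

Lemma hyper_bessel_limit_bounds : exists m : R,
  [/\ 0 < m, F m^-1 = 0,
    forall t, 0 <= t -> m * t < 1 ->
      [/\ expR (P^-1 / m * ln (1 - m * t)) <= F t, F t <= 1 - m * t &
          F t <= expR (- P^-1 * t)] &
    exists2 k : R, 0 < k &
      forall t, 0 <= t -> m * t < 1 -> k * (m^-1 - t) <= F t].
Proof.
pose i0 := Ordinal d0.
have /choice[ss ssP] : forall N, exists ss : seq R * seq R,
    [/\ {in ss.1, forall c, 0 <= c}, {in ss.2, forall c, 0 <= c},
       linprod ss.1 = euler_step (b i0)^-1 (linprod ss.2) &
       forall n, (linprod ss.1)`_n = laguerre_weight b N n * hb_coef b n].
  move=> N; have [s [s' ?]] := hyper_bessel_approximant i0 N b0.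
  by exists (s, s').
pose s N := (ss N).1.
have s0 N : {in s N, forall c, 0 <= c} by case: (ssP N).
have sC N n : (linprod (s N))`_n = laguerre_weight b N n * hb_coef b n.
  by case: (ssP N).
have w01 N n : 0 <= laguerre_weight b N n <= 1 by apply: laguerre_weight_itv.
pose S N := \sum_(c <- s N) c.
have SE N : S N = laguerre_weight b N 1 / P.
  by apply: oppr_inj; rewrite -linprod_coef1 sC hb_coef1 mulrN.
have S_gt0 N : 0 < S N.
  rewrite SE divr_gt0 // /laguerre_weight big_ord1 mul0r subr0 mul1r.
  apply: prodr_gt0 => i _; rewrite big_ord1 addr0 divr_gt0 //.
    by rewrite addr_gt0 ?ltr0n.
  by rewrite !addr_gt0 ?ltr0n.
have /choice[m_ mP] : forall N, exists m, m \in s N /\ {in s N, forall c, c <= m}.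
  move=> N; have [|m ms mP] := @exists_max_seq R (s N); last by exists m.
  by apply: contraTneq (S_gt0 N) => e; rewrite /S e big_nil ltxx.
have ms N : m_ N \in s N by case: (mP N).
have sm N : {in s N, forall c, c <= m_ N} by case: (mP N).
have mS N : m_ N <= S N by apply: max_le_sum.
have SP N : S N <= P^-1.
  by rewrite SE ler_piMl ?invr_ge0 ?(ltW P0) //; case/andP: (w01 N 1%N).
(* The maxima lie in [0, 1/P], because [m_ N <= S N <= P^-1]. *)
have [|f fi /cvg_ex[m mcvg]] := @bolzano_weierstrass R m_.
  exists P^-1; split; first exact: num_real.
  move=> x Px n _ /=; rewrite ger0_norm; last exact: s0.
  exact: le_trans (mS n) (le_trans (SP n) (ltW Px)).
have foo := increasing_seq_cvgn fi.
have wcvg n : laguerre_weight b (f N) n @[N --> \oo] --> (1 : R).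
  exact: (cvg_comp _ _ foo (cvg_laguerre_weight _ b0)).
have Fcvg t : (linprod (s (f N))).[t] @[N --> \oo] --> F t.
  have h := @cvg_hyper_bessel_approximant _ _ b (fun N => linprod (s N)) t b0 sC.
  exact: (cvg_comp _ _ foo h).
have Scvg : S (f N) @[N --> \oo] --> P^-1.
  rewrite (_ : (fun N => S (f N)) = (fun N => laguerre_weight b (f N) 1 / P)).
    by rewrite -[X in _ --> X]mul1r; apply: cvgMr_tmp.
  by apply/funext => N; exact: SE.
have mtcvg t : m_ (f N) * t @[N --> \oo] --> m * t.
  by apply: cvgMr_tmp; exact: mcvg.
have expcvg (u : nat -> R) (l : R) :
    u N @[N --> \oo] --> l -> expR (u N) @[N --> \oo] --> expR l.
  by move=> ul; apply: continuous_cvg => //; exact: continuous_expR.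
(* In the limit, [sum_sqr_le] becomes P^-1 (P^-1 - B^-1) <= m P^-1, with B > P. *)
have m_gt0 : 0 < m.
  pose B := \prod_(i < d) (b i + 1).
  have PB : P < B := ltr_prod_shift.
  have B0 : 0 < B := lt_trans P0 PB.
  have h1 : S (f N) ^+ 2 - laguerre_weight b (f N) 2 * hb_coef b 2 *+ 2
      @[N --> \oo] --> P^-1 ^+ 2 - 1 * hb_coef b 2 *+ 2.
    apply: cvgB; first by apply: cvgM; exact: Scvg.
    by apply: cvgMn; apply: cvgMr_tmp; exact: wcvg.
  have h2 : m_ (f N) * S (f N) @[N --> \oo] --> m * P^-1.
    by apply: cvgM; [exact: mcvg|exact: Scvg].
  have : P^-1 ^+ 2 - 1 * hb_coef b 2 *+ 2 <= m * P^-1.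
    apply: (ler_cvg_to h1 h2); apply: nearW => N.
    rewrite -sC -linprod_coef2; exact: sum_sqr_le.
  rewrite hb_coef2 mul1r => h3.
  rewrite -(pmulr_lgt0 m (_ : 0 < P^-1)) ?invr_gt0 //; apply: lt_le_trans h3.
  rewrite (_ : _ - _ = P^-1 * (P^-1 - B^-1)); last first.
    by rewrite -/P -/B; field; rewrite !gt_eqF.
  by rewrite mulr_gt0 ?invr_gt0 // subr_gt0 ltf_pV2 ?posrE.
have mi0 : 0 <= m^-1 by rewrite invr_ge0 ltW.
have near0 : \forall N \near \oo, 0 < m_ (f N) := cvgr_gt _ mcvg _ m_gt0.
have near1 t : m * t < 1 -> \forall N \near \oo, m_ (f N) * t < 1.
  by move=> mt; exact: cvgr_lt _ (mtcvg t) _ mt.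
have lim1 t : (1 - m_ (f N) * t) @[N --> \oo] --> 1 - m * t.
  by apply: cvgB; [exact: cvg_cst|exact: mtcvg].
exists m; split=> //.
(* The approximants at [m^-1] are bounded by a multiple of |1 - m_N/m|, which tends to 0, with a
   convergent exponential as multiplier. *)
- have h1 : `|(linprod (s (f N))).[m^-1]| @[N --> \oo] --> `|F m^-1|.
    by apply: cvg_norm; exact: Fcvg.
  have h2 : `|1 - m_ (f N) * m^-1| * expR (S (f N) * m^-1) @[N --> \oo] -->
      `|1 - m * m^-1| * expR (P^-1 * m^-1).
    apply: cvgM; first by apply: cvg_norm; exact: lim1.
    by apply: expcvg; apply: cvgMr_tmp; exact: Scvg.
  have : `|F m^-1| <= `|1 - m * m^-1| * expR (P^-1 * m^-1).
    apply: (ler_cvg_to h1 h2); apply: nearW => N.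
    exact: normr_linprod_le.
  rewrite divff ?gt_eqF // subrr normr0 mul0r normr_le0.
  by move/eqP.
- move=> t t0 mt; split.
  + have h : expR (S (f N) / m_ (f N) * ln (1 - m_ (f N) * t)) @[N --> \oo] -->
        expR (P^-1 / m * ln (1 - m * t)).
      apply: expcvg; apply: cvgM.
        apply: cvgM; first exact: Scvg.
        by apply: cvgV; [rewrite gt_eqF|exact: mcvg].
      apply: continuous_cvg; last exact: lim1.
      by apply: continuous_ln; rewrite subr_gt0.
    apply: (ler_cvg_to h (Fcvg t)); near=> N.
    apply: linprod_ge_powR => //; near: N; [exact: near0|exact: near1].
  + apply: (ler_cvg_to (Fcvg t) (lim1 t)); near=> N.
    by apply: linprod_le_linear => //; apply: ltW; near: N; exact: near1.
  + have h : expR (- S (f N) * t) @[N --> \oo] --> expR (- P^-1 * t).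
      by apply: expcvg; apply: cvgMr_tmp; apply: cvgN; exact: Scvg.
    apply: (ler_cvg_to (Fcvg t) h); near=> N.
    by apply: linprod_le_expR => //; apply: ltW; near: N; exact: near1.
- have b1 : 0 < 1 + b i0 by rewrite addr_gt0.
  (* The limit of the constants in [euler_step_linprod_ge] with [c = b i0], as the sums tend to
     [P^-1]. *)
  exists (expR (- b i0) * (P^-1 / (1 + b i0))).
    by rewrite mulr_gt0 ?expR_gt0 // divr_gt0 // invr_gt0.
  move=> t t0 mt.
  have h : expR (- b i0) * (S (f N) / (1 + b i0)) * ((m_ (f N))^-1 - t)
      @[N --> \oo] --> expR (- b i0) * (P^-1 / (1 + b i0)) * (m^-1 - t).
    apply: cvgM.
      by apply: cvgMl_tmp; apply: cvgMr_tmp; exact: Scvg.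
    apply: cvgB; last exact: cvg_cst.
    by apply: cvgV; [rewrite gt_eqF|exact: mcvg].
  apply: (ler_cvg_to h (Fcvg t)); near=> N.
  have mN0 : 0 < m_ (f N) by near: N; exact: near0.
  case: (ssP (f N)) => _ s'0 ss' _.
  apply: euler_step_linprod_ge ss' _ _ => //; first exact: sm.
  rewrite t0 /= -(@ler_pM2l _ (m_ (f N))) // divff ?gt_eqF // ltW //.
  by near: N; exact: near1.
Unshelve. all: by end_near.
Qed.
End FirstZero.

Local Close Scope classical_set_scope.

(** * Optimal exponents and the return to the variable x *)

Lemma powRE_gt0 (R : realType) (x c : R) : 0 < x -> x `^ c = expR (c * ln x).
Proof. by move=> x0; rewrite /powR gt_eqF. Qed.

(** Logarithms give a u <= c ln(1/(1 - u)). For c <= 0 this fails at u = 1/2; for c > 0 it yields a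
    (1 - u) <= c, so small u forces a <= c. *)
Lemma exponent_ge (R : realType) (a c : R) : 0 < a ->
  (forall u : R, 0 < u < 1 -> (1 - u) `^ c <= expR (- (a * u))) -> a <= c.
Proof.
move=> a0 h; rewrite leNgt; apply/negP => ca.
have h' (u : R) : 0 < u < 1 -> a * u <= c * ln (1 - u)^-1.
  move=> /andP[u0 u1]; have v0 : 0 < 1 - u by rewrite subr_gt0.
  have := h u; rewrite u0 u1 powRE_gt0 // ler_expR => /(_ isT).
  by rewrite lnV ?posrE // mulrN lerNr.
have [c0|c0] := leP c 0.
  have /h' : 0 < (2^-1 : R) < 1 by rewrite invr_gt0 ltr0n invf_lt1 ?ltr1n ?ltr0n.
  apply/negP; rewrite -ltNge; apply: (@le_lt_trans _ _ 0).
    rewrite mulr_le0_ge0 // ln_ge0 // invf_ge1; lra.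
  by rewrite mulr_gt0 // invr_gt0.
(* Here [a * (1 - u)] is the midpoint of [a] and [c], hence exceeds [c]. *)
pose u := (a - c) / (2 * a).
have u01 : 0 < u < 1.
  rewrite divr_gt0 ?subr_gt0 ?mulr_gt0 //= ltr_pdivrMr ?mulr_gt0 //; lra.
have /andP[u0 u1] := u01.
have v0 : 0 < 1 - u by rewrite subr_gt0.
have lnu : ln (1 - u)^-1 <= u / (1 - u).
  have := @le_ln1Dx R ((1 - u)^-1 - 1).
  rewrite [1 + (_ - 1)]addrC subrK (_ : _ - 1 = u / (1 - u)); last first.
    by field; rewrite gt_eqF.
  by apply; rewrite (lt_trans (ltrN10 _)) // divr_gt0.
have := le_trans (h' u u01) (ler_wpM2l (ltW c0) lnu).
rewrite [leRHS]mulrA ler_pdivlMr // mulrAC ler_pM2r //.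
rewrite mulrBr mulr1 (_ : a * u = (a - c) / 2); last first.
  by rewrite /u; field; rewrite gt_eqF.
lra.
Qed.

Lemma exponent_le1 (R : realType) (k c : R) : 0 < k ->
  (forall v : R, 0 < v < 1 -> k * v <= v `^ c) -> c <= 1.
Proof.
move=> k0 h; rewrite leNgt; apply/negP => c1.
(* At v = e^(-y) the hypothesis reads k <= e^(-1/k), contradicting e^(1/k) >= 1 + 1/k. *)
pose y := ((c - 1) * k)^-1.
have y0 : 0 < y by rewrite invr_gt0 mulr_gt0 // subr_gt0.
have := h (expR (- y)); rewrite expR_gt0 expR_lt1 oppr_lt0 y0 => /(_ isT).
rewrite powRE_gt0 ?expR_gt0 // expRK -ler_pdivlMr ?expR_gt0 //.
rewrite -expRN opprK -expRD (_ : _ + y = - k^-1); last first.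
  by rewrite /y; field; rewrite gt_eqF //= gt_eqF // subr_gt0.
rewrite expRN -[leLHS]invrK lef_pV2 ?posrE ?expR_gt0 ?invr_gt0 //.
apply/negP; rewrite -ltNge; apply: lt_le_trans (expR_ge1Dx _).
by rewrite ltrDr.
Qed.

Lemma exists_expr_eq (R : realType) (n : nat) (t : R) : 0 < t ->
  exists2 y : R, 0 < y & y ^+ n.+1 = t.
Proof.
move=> t0; exists (t `^ n.+1%:R^-1); first exact: powR_gt0.
by rewrite -powR_mulrn ?powR_ge0 // -powRrM mulVf ?pnatr_eq0 // powRr1 // ltW.
Qed.

Lemma hyper_besselE (R : realType) (d : nat) (alpha : 'I_d -> R) (x : R) :
  hyper_bessel alpha x = limn (series (fun n =>
    hb_coef (fun i => alpha i + 1) n * ((x / d.+1%:R) ^+ d.+1) ^+ n)).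
Proof.
rewrite /hyper_bessel; congr (limn (series _)).
by apply/funext => n; rewrite /hyper_bessel_term mulnC exprM.
Qed.
Theorem theorem7 (R : realType) (d : nat) (hd : (1 <= d)%N)
    (alpha : 'I_d -> R) (halpha : forall i : 'I_d, -1 < alpha i) :
  let j := hyper_bessel_zero1 alpha in
  let A := \prod_(i < d) (alpha i + 1) in
  let a := j ^+ d.+1 / (d.+1%:R ^+ d.+1 * A) in
  let b := 1 : R in
  [/\ forall x : R, 0 < x < j ->
        redheffer_base alpha x `^ a <= hyper_bessel alpha x
                                    <= redheffer_base alpha x `^ b,
      forall c : R,
        (forall x : R, 0 < x < j ->
           redheffer_base alpha x `^ c <= hyper_bessel alpha x) ->
        a <= c
    & forall c : R,
        (forall x : R, 0 < x < j ->
           hyper_bessel alpha x <= redheffer_base alpha x `^ c) ->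
        c <= b].
Proof.
move=> j A a b.
have b0 i : 0 < alpha i + 1 by rewrite -ltrBlDr sub0r.
have [m [m0 Fm Fbounds [k k0 Fk]]] := hyper_bessel_limit_bounds hd b0.
set F := fun t : R => limn (series
  (fun n => hb_coef (fun i => alpha i + 1) n * t ^+ n)) in Fm Fbounds Fk.
(* An increasing bijection of the positive half-line, which carries zeros in [x] to zeros of [F]. *)
pose T (x : R) := (x / d.+1%:R) ^+ d.+1.
have JE x : hyper_bessel alpha x = F (T x) by exact: hyper_besselE.
have n0 : 0 < d.+1%:R :> R by rewrite ltr0n.
have T_gt0 x : 0 < x -> 0 < T x by move=> x0; rewrite exprn_gt0 // divr_gt0.
have T_lt x y : 0 < x -> 0 < y -> (T x < T y) = (x < y).
  move=> x0 y0; rewrite ltr_pXn2r ?nnegrE ?divr_ge0 ?(ltW x0) ?(ltW y0) ?(ltW n0) //.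
  by rewrite ltr_pM2r // invr_gt0.
have T_surj t : 0 < t -> exists2 x, 0 < x & T x = t.
  move=> t0; have [y y0 yt] := exists_expr_eq d t0.
  exists (y * d.+1%:R); first by rewrite mulr_gt0.
  by rewrite /T mulfK // gt_eqF.
have mT t : (m * t < 1) = (t < m^-1) by rewrite -ltr_pdivlMl // mulr1.
have mi0 : 0 < m^-1 by rewrite invr_gt0.
have F_gt0 t : 0 <= t -> t < m^-1 -> 0 < F t.
  move=> t0; rewrite -mT => mt; case: (Fbounds t t0 mt) => h _ _.
  exact: lt_le_trans (expR_gt0 _) h.
have [j0 j0_gt0 Tj0] := T_surj _ mi0.
have j0P : smallest_pos_zero (hyper_bessel alpha) j0.
  split=> //; first by rewrite JE Tj0.
  move=> y y0; rewrite JE leNgt => Fy; apply/negP => yj0.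
  by move: (F_gt0 (T y)); rewrite Fy ltxx ltW ?T_gt0 // -Tj0 T_lt // => /(_ isT yj0).
(* The witness [j0] ensures that [xget] returns a genuine zero and not its default 0. *)
have [j_gt0 Jj jmin] : smallest_pos_zero (hyper_bessel alpha) j.
  exact: (@xgetPex _ 0 [set z | smallest_pos_zero (hyper_bessel alpha) z]%classic
            (ex_intro _ j0 j0P)).
have jE : j = j0.
  apply/eqP; rewrite eq_le jmin //=; last by case: j0P.
  by case: j0P => _ _; apply.
have Tj : T j = m^-1 by rewrite jE.
have jXE : j ^+ d.+1 = d.+1%:R ^+ d.+1 / m.
  rewrite -Tj /T expr_div_n mulrC divfK // expf_neq0 // gt_eqF //.
have redE x : redheffer_base alpha x = 1 - m * T x.
  rewrite /redheffer_base -/j jXE /T expr_div_n; field.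
  by rewrite expf_neq0 gt_eqF.
have A0 : 0 < A by apply: prodr_gt0 => i _; exact: b0.
have aE : a = A^-1 / m.
  by rewrite /a jXE; field; rewrite expf_neq0 !gt_eqF.
have a_gt0 : 0 < a by rewrite aE divr_gt0 // invr_gt0.
have range x : 0 < x < j -> [/\ 0 <= T x, m * T x < 1 & 0 < 1 - m * T x].
  move=> /andP[x0 xj]; have mTx : m * T x < 1 by rewrite mT -Tj T_lt.
  by rewrite subr_gt0; split=> //; rewrite ltW ?T_gt0.
have range_inv u : 0 < u < 1 -> exists2 x, 0 < x < j & m * T x = u.
  move=> /andP[u0 u1]; have [|x x0 Tx] := T_surj (u / m); first exact: divr_gt0.
  exists x; last by rewrite Tx mulrC divfK // gt_eqF.
  by rewrite x0 -T_lt // Tx Tj ltr_pdivrMr // mulVf // gt_eqF.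
split.
- move=> x /range[Tx0 mTx v0]; rewrite redE JE /b powRr1 ?(ltW v0) //.
  rewrite powRE_gt0 // aE.
  by case: (Fbounds _ Tx0 mTx) => -> -> _.
(* With u = m T(x), the bound F(t) <= e^(-t/A) at t = T(x) is exactly e^(-a u). *)
- move=> c hc; apply: exponent_ge => // u /range_inv[x xj <-].
  have [Tx0 mTx _] := range x xj.
  case: (Fbounds _ Tx0 mTx) => _ _ hF.
  move: (hc x xj); rewrite redE JE => /le_trans; apply.
  by rewrite (_ : - (a * _) = - A^-1 * T x) // aE mulNr mulrA divfK // gt_eqF.
(* With v = 1 - m T(x), the linear bound k (1/m - T(x)) equals (k/m) v. *)
- move=> c hc; apply: (@exponent_le1 _ (k / m)); first exact: divr_gt0.
  move=> v v01; have [|x xj xv] := range_inv (1 - v); first lra.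
  have [Tx0 mTx _] := range x xj.
  move: (hc x xj); rewrite redE JE xv opprB addrC subrK; apply: le_trans.
  apply: le_trans (Fk _ Tx0 mTx).
  rewrite (_ : v = 1 - m * T x); last by rewrite xv; ring.
  rewrite le_eqVlt; apply/orP; left; apply/eqP; field; rewrite gt_eqF //.
Qed.
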